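(* Let $\mathcal R = (\Sigma, E, R)$ be a rewrite theory with a given set of strategy definitions, let $\alpha$ be a strategy expression and $t$ a ground term. If the set $\{ q \in \mathcal{XS} : t \mathbin{@} \alpha \to_{s,c}^* q \}$ of reachable execution states from $t \mathbin{@} \alpha$ is finite, then $E(\alpha, t)$ is a closed $\infty$-regular language.
   Context: **Languages.** A language $L$ of finite and infinite words over an alphabet $A$ is closed if it contains all its accumulation points, where an infinite word $w$ is an accumulation point of $L$ if for every $n\in\mathbb N$ some word in $L$ has the length-$n$ prefix of $w$ as a prefix. $L$ is $\infty$-regular if its finite words form a regular language and its infinite words form an $\omega$-regular language (recognized by a nondeterministic Büchi automaton), over a finite alphabet. Here letters are terms. **Rewriting.** $\mathcal R = (\Sigma, E, R)$ is a rewrite theory over a membership equational theory $(\Sigma,E)$, with labeled rules, possibly conditional, with condition fragments that are equations, sort memberships, or rewriting conditions $l \Rightarrow p$. Terms are considered modulo $E$, and $T_\Sigma$ denotes ground terms (modulo $E$). $t \to^1_R t'$ is one-step rewriting. **Strategy expressions.** Core grammar: $\alpha ::= \mathtt{idle} \mid \mathtt{fail} \mid \mathtt{match}\,P\,\mathtt{s.t.}\,C \mid \alpha;\alpha \mid \alpha|\alpha \mid \alpha^* \mid \alpha\,?\,\alpha:\alpha \mid \mathtt{matchrew}\,P\,\mathtt{s.t.}\,C\,\mathtt{by}\,x_1\,\mathtt{using}\,\alpha_1,\ldots,x_n\,\mathtt{using}\,\alpha_n \mid sl(t_1,\ldots,t_n) \mid \mathtt{all} \mid rl[\rho]\{\alpha_1,\ldots,\alpha_m\}$,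 where $C$ is an equational condition, $rl$ is a rule label, $\rho$ is an optional initial substitution $x_1 \leftarrow t_1,\ldots$, the list of $m\ge0$ strategies is for a rule with $m$ rewriting conditions, and $sl$ is a strategy name given by definitions $sl(p_1,\ldots,p_n) := \delta$ (optionally: if an equational condition holds), which may be mutually recursive. Rule applications may be wrapped in $\mathtt{top}(\cdot)$ to apply only at the root. (Variants $\mathtt{amatch}$, $\mathtt{amatchrew}$ match at any position; $\mathtt{xmatch}$, $\mathtt{xmatchrew}$ match with extension.) Other combinators are abbreviations. **Execution states** $\mathcal{XS}$: $q ::= t \mathbin{@} s \mid \mathrm{subterm}(x_1:q_1,\ldots,x_n:q_n;t)\mathbin{@} s \mid \mathrm{rewc}(p:q,\sigma,C,\vec\alpha,\theta,r,c;t)\mathbin{@} s$, with stacks $s ::= \varepsilon \mid \alpha s \mid \theta s$ of strategy expressions $\alpha$ and substitutions $\theta$. $\mathrm{vctx}(\theta s)=\theta$, $\mathrm{vctx}(\varepsilon)=\mathrm{id}$, $\mathrm{vctx}(\alpha s)=\mathrm{vctx}(s)$. Current term: $\mathrm{cterm}(t\mathbin{@} s)=t$, $\mathrm{cterm}(\mathrm{rewc}(\ldots;t)\mathbin{@} s)=t$, $\mathrm{cterm}(\mathrm{subterm}(x_1:q_1,\ldots,x_n:q_n;t)\mathbin{@} s)=t[x_1/\mathrm{cterm}(q_1),\ldots,x_n/\mathrm{cterm}(q_n)]$. States $t\mathbin{@}\varepsilon$ are solutions. **Transitions** ($\to_c$ control, $\to_s$ system, $\to_{s,c} = \to_s\cup\to_c$),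 where $\theta=\mathrm{vctx}(s)$ instantiates the variables of the expressions: - $t\mathbin{@}\mathtt{idle}\,s\to_c t\mathbin{@} s$; no rule for $\mathtt{fail}$; $t\mathbin{@}\theta' s\to_c t\mathbin{@} s$ (popping a substitution). - $t\mathbin{@}(\mathtt{match}\,P\,\mathtt{s.t.}\,C)\,s\to_c t\mathbin{@} s$ if $t$ matches $P$ satisfying $C$. - $t\mathbin{@}(\alpha;\beta)s\to_c t\mathbin{@}\alpha\beta s$; $t\mathbin{@}(\alpha|\beta)s\to_c t\mathbin{@}\alpha s$ and $\to_c t\mathbin{@}\beta s$; $t\mathbin{@}\alpha^* s\to_c t\mathbin{@} s$ and $\to_c t\mathbin{@}\alpha\,\alpha^* s$. - $t\mathbin{@}(\alpha?\beta:\gamma)s\to_c t\mathbin{@}\alpha\beta s$; and $t\mathbin{@}(\alpha?\beta:\gamma)s\to_c t\mathbin{@}\gamma s$ if $\to_{s,c}$ is terminating from $t\mathbin{@}\alpha\theta$ and reaches no solution from it. - $t\mathbin{@}\mathtt{all}\,s\to_s t'\mathbin{@} s$ if $t\to^1_R t'$. For a rule labeled $rl$ without rewriting conditions, $t\mathbin{@} rl[\rho]s\to_s t'\mathbin{@} s$ for each $t'$ obtained from $t$ by applying, at some position, that rule instantiated first by $\rho$ (whose terms are instantiated by $\theta$). - For a rule labeled $rl$ with right-hand side $r$ and condition $C_0\wedge l_1\Rightarrow p_1\wedge C'$ with $C_0$ equational and $m\ge1$ rewriting fragments in total: $t\mathbin{@} rl[\rho]\{\alpha_1,\ldots,\alpha_m\}s\to_c\mathrm{rewc}(p_1:\sigma(l_1)\mathbin{@}\alpha_1\theta,\sigma,C',\alpha_2\cdots\alpha_m,\theta,r,c;t)\mathbin{@}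 s$ for each context $c$ and substitution $\sigma$ (extending $\rho$) matching the left-hand side in $t$ and satisfying $C_0$. If $q\to_s q'$ or $q\to_c q'$, then $\mathrm{rewc}(p:q,\ldots)\mathbin{@} s\to_c\mathrm{rewc}(p:q',\ldots)\mathbin{@} s$. For each $\sigma'$ extending $\sigma$ with $\sigma'(p)=t'$ and satisfying the equational condition $C_0$: $\mathrm{rewc}(p:t'\mathbin{@}\varepsilon,\sigma,C_0\wedge l\Rightarrow p'\wedge C,\alpha\vec\alpha,\theta,r,c;t)\mathbin{@} s\to_c\mathrm{rewc}(p':\sigma'(l)\mathbin{@}\alpha\theta,\sigma',C,\vec\alpha,\theta,r,c;t)\mathbin{@} s$, and, when no rewriting fragment remains, $\mathrm{rewc}(p:t'\mathbin{@}\varepsilon,\sigma,C_0,\ldots,r,c;t)\mathbin{@} s\to_s c(\sigma'(r))\mathbin{@} s$. - $t\mathbin{@}(\mathtt{matchrew}\,P\,\mathtt{s.t.}\,C\,\mathtt{by}\,x_1\,\mathtt{using}\,\alpha_1,\ldots)s\to_c\mathrm{subterm}(x_1:\sigma(x_1)\mathbin{@}\alpha_1\sigma,\ldots,x_n:\sigma(x_n)\mathbin{@}\alpha_n\sigma;\sigma_{-\{x_1,\ldots,x_n\}}(P))\mathbin{@} s$ for each match $\sigma$ of $t$ with $P$ satisfying $C$ and extending $\theta$ ($\sigma_{-X}$ leaves the variables in $X$ untouched). If $q_i\to_\bullet q_i'$ with $\bullet\in\{s,c\}$, then $\mathrm{subterm}(\ldots,x_i:q_i,\ldots;t)\mathbin{@}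 s\to_\bullet\mathrm{subterm}(\ldots,x_i:q_i',\ldots;t)\mathbin{@} s$. $\mathrm{subterm}(x_1:t_1\mathbin{@}\varepsilon,\ldots,x_n:t_n\mathbin{@}\varepsilon;t)\mathbin{@} s\to_c t[x_1/t_1,\ldots,x_n/t_n]\mathbin{@} s$. - $t\mathbin{@} sl(t_1,\ldots,t_n)s\to_c t\mathbin{@}\delta\sigma s$ for every definition whose left-hand side matches the call instantiated by $\theta$, with substitution $\sigma$ (and condition satisfied), $\delta$ being its right-hand side; if the top of $s$ is a substitution, it is replaced by $\sigma$ (tail call). **Denotation.** $\twoheadrightarrow$ is $\to_c^*$ followed by one $\to_s$. $\mathrm{Ex}^*(\alpha,t)=\{q_0\cdots q_n: q_0=t\mathbin{@}\alpha,\ q_k\twoheadrightarrow q_{k+1},\ q_n\to_c^* t'\mathbin{@}\varepsilon \text{ for some } t'\in T_\Sigma\}$, $\mathrm{Ex}^\omega(\alpha,t)=\{(q_k)_{k\ge0}: q_0=t\mathbin{@}\alpha,\ q_k\twoheadrightarrow q_{k+1}\}$, and $E(\alpha,t)=\mathrm{cterm}(\mathrm{Ex}^*(\alpha,t)\cup\mathrm{Ex}^\omega(\alpha,t))$ (cterm applied letterwise). *)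

(* Defs.v *)
From Stdlib Require List Operators_Properties.
From Stdlib Require Import Relation_Operators.
From mathcomp Require Import all_boot.
From mathcomp Require Import boolp classical_sets cardinality.

Set Implicit Arguments.
Unset Strict Implicit.
Unset Printing Implicit Defensive.

Local Open Scope classical_set_scope.

(** * Languages of finite and infinite words *)

Section Languages.
Variable A : Type.

Inductive word := Fin of seq A | Inf of (nat -> A).

(* [wprefix n w] is shorter than [n] when [w] is. *)
Definition wprefix (n : nat) (w : word) : seq A :=
  match w with Fin u => take n u | Inf f => mkseq f n end.

Definition accumulation_point (L : set word) (w : nat -> A) : Prop :=
  forall n, exists2 v, L v & wprefix n v = mkseq w n.

Definition closed_language (L : set word) : Prop :=
  forall w, accumulation_point L w -> L (Inf w).

(* Nondeterministic automata, read below both as finite automata and as Büchi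
   automata. Only the letters of a given finite alphabet [S] are ever read. *)
Record automaton := Automaton {
  astate : finType;
  ainit  : set astate;
  atrans : astate -> A -> set astate;
  afinal : set astate }.

Fixpoint accepts_from (M : automaton) (p : astate M) (u : seq A) : Prop :=
  if u is a :: u' then exists2 p', atrans p a p' & accepts_from p' u'
  else afinal p.

Definition accepts (M : automaton) (u : seq A) : Prop :=
  exists2 p, @ainit M p & accepts_from p u.

Definition buchi_accepts (M : automaton) (w : nat -> A) : Prop :=
  exists r : nat -> astate M,
    [/\ ainit (r 0),
        forall n, atrans (r n) (w n) (r n.+1)
      & forall n, exists2 m, n <= m & afinal (r m)].

Definition regular (S : set A) (L : set (seq A)) : Prop :=
  exists M : automaton,
    L = [set u | List.Forall S u /\ accepts M u].

Definition omega_regular (S : set A) (L : set (nat -> A)) : Prop :=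
  exists M : automaton,
    L = [set w | (forall n, S (w n)) /\ buchi_accepts M w].

Definition infty_regular (L : set word) : Prop :=
  exists S : set A,
    [/\ finite_set S,
        regular S [set u | L (Fin u)]
      & omega_regular S [set w | L (Inf w)]].

End Languages.

Definition wmap (A B : Type) (f : A -> B) (w : word A) : word B :=
  match w with Fin u => Fin (map f u) | Inf g => Inf (f \o g) end.

(** * Membership equational logic *)

Record signature := Signature {
  kind : eqType;
  sort : eqType;
  kind_of : sort -> kind;
  op : Type;
  arity : op -> seq kind;
  cokind : op -> kind }.

(* Variables range over a sort or over a whole kind. *)
Definition var (Sg : signature) : eqType := (nat * (sort Sg + kind Sg))%type.

Inductive term (Sg : signature) :=
  | Var of var Sg
  | App of op Sg & seq (term Sg).

(* Atomic formulas: equations and sort memberships. *)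
Inductive atom (Sg : signature) :=
  | Eqn of term Sg & term Sg
  | Mem of term Sg & sort Sg.

(* A conditional equation or membership. *)
Record sentence (Sg : signature) := Sentence {
  concl : atom Sg;
  premises : seq (atom Sg) }.

Inductive fragment (Sg : signature) :=
  | FAtom of atom Sg
  | FRew of term Sg & term Sg.

Record rule (Sg : signature) (Lbl : Type) := Rule {
  rlabel : Lbl;
  lhs : term Sg;
  rhs : term Sg;
  rcond : seq (fragment Sg) }.

Section Terms.
Variable Sg : signature.
Local Notation var := (var Sg).
Local Notation term := (term Sg).
Local Notation atom := (atom Sg).

Definition vkind (x : var) : kind Sg :=
  match x.2 with inl s => kind_of s | inr k => k end.

Fixpoint tvars (t : term) : seq var :=
  match t with Var x => [:: x] | App _ ts => flatten (map tvars ts) end.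

Fixpoint subst (g : var -> term) (t : term) : term :=
  match t with Var x => g x | App f ts => App f (map (subst g) ts) end.

Fixpoint tkind (t : term) : option (kind Sg) :=
  match t with
  | Var x => Some (vkind x)
  | App f ts =>
      if map tkind ts == map Some (arity f) then Some (cokind f) else None
  end.

(* [t] is a well-formed term of kind [k] over the variables [X]. *)
Definition wk (X : seq var) (t : term) (k : kind Sg) : Prop :=
  tkind t = Some k /\ {subset tvars t <= X}.

Definition ground (t : term) : Prop := exists k, wk [::] t k.

Definition avars (a : atom) : seq var :=
  match a with Eqn u v => tvars u ++ tvars v | Mem u _ => tvars u end.

Definition asubst (g : var -> term) (a : atom) : atom :=
  match a with
  | Eqn u v => Eqn (subst g u) (subst g v)
  | Mem u s => Mem (subst g u) s
  end.

Definition wk_atom (a : atom) : Prop :=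
  match a with
  | Eqn u v => tkind u <> None /\ tkind u = tkind v
  | Mem u s => tkind u = Some (kind_of s)
  end.

(* A variable of a sort [s] abbreviates a variable of the kind of [s] together
   with the condition that it has sort [s]. *)
Definition sort_conds (xs : seq var) : seq atom :=
  pmap (fun x : var => if x.2 is inl s then Some (Mem (Var x) s) else None) xs.

Definition svars (e : sentence Sg) : seq var :=
  avars (concl e) ++ flatten (map avars (premises e)).

Definition fvars (c : fragment Sg) : seq var :=
  match c with FAtom a => avars a | FRew l p => tvars l ++ tvars p end.

Definition fragvars (C : seq (fragment Sg)) : seq var := flatten (map fvars C).

Definition wk_sentence (e : sentence Sg) : Prop :=
  wk_atom (concl e) /\ List.Forall wk_atom (premises e).

Definition wk_fragment (c : fragment Sg) : Prop :=
  match c with FAtom a => wk_atom a | FRew l p => wk_atom (Eqn l p) end.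

Definition wk_rule (Lbl : Type) (r : rule Sg Lbl) : Prop :=
  wk_atom (Eqn (lhs r) (rhs r)) /\ List.Forall wk_fragment (rcond r).

Definition is_rew (c : fragment Sg) : bool :=
  if c is FRew _ _ then true else false.

End Terms.

Record rewrite_theory (Sg : signature) (Lbl : Type) := RewriteTheory {
  axioms : set (sentence Sg);
  rules : set (rule Sg Lbl);
  axioms_wk : forall e, axioms e -> wk_sentence e;
  rules_wk : forall r, rules r -> wk_rule r }.

(** * Strategy expressions *)

(* The modes of [match], [xmatch] and [amatch], and of the three [matchrew]. *)
Inductive mmode := AtRoot | WithExtension | Anywhere.

(* The boolean of [All] and [Rl] tells whether they are wrapped in [top]. *)
Inductive strategy (Sg : signature) (Lbl Nm : Type) :=
  | Idle
  | Fail
  | Match of mmode & term Sg & seq (atom Sg)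
  | Seq of strategy Sg Lbl Nm & strategy Sg Lbl Nm
  | Alt of strategy Sg Lbl Nm & strategy Sg Lbl Nm
  | Star of strategy Sg Lbl Nm
  | Cond of strategy Sg Lbl Nm & strategy Sg Lbl Nm & strategy Sg Lbl Nm
  | Matchrew of mmode & term Sg & seq (atom Sg)
      & seq (var Sg * strategy Sg Lbl Nm)
  | Call of Nm & seq (term Sg)
  | All of bool
  | Rl of bool & Lbl & seq (var Sg * term Sg) & seq (strategy Sg Lbl Nm).

Arguments Idle {Sg Lbl Nm}.
Arguments Fail {Sg Lbl Nm}.
Arguments Match {Sg Lbl Nm}.
Arguments Call {Sg Lbl Nm}.
Arguments All {Sg Lbl Nm}.

Record strategy_def (Sg : signature) (Lbl Nm : Type) := StrategyDef {
  dname : Nm;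
  dparams : seq (term Sg);
  dcond : seq (atom Sg);
  dbody : strategy Sg Lbl Nm }.

(* Finite substitutions, as partial functions. *)
Definition substitution (Sg : signature) := var Sg -> option (term Sg).

Definition stack (Sg : signature) (Lbl Nm : Type) :=
  seq (strategy Sg Lbl Nm + substitution Sg).

(** * Execution states *)

(* [XSub xqs t s] is subterm(x_1 : q_1, ..., x_n : q_n; t) @ s and
   [XRewc p q sigma C alphas theta r c t s] is
   rewc(p : q, sigma, C, alphas, theta, r, c; t) @ s. *)
Inductive xstate (Sg : signature) (Lbl Nm : Type) :=
  | XT of term Sg & stack Sg Lbl Nm
  | XSub of seq (var Sg * xstate Sg Lbl Nm) & term Sg & stack Sg Lbl Nm
  | XRewc of term Sg & xstate Sg Lbl Nm & substitution Sg
      & seq (fragment Sg) & seq (strategy Sg Lbl Nm) & substitution Sg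
      & term Sg & term Sg & term Sg & stack Sg Lbl Nm.

(* Control and system transitions. *)
Inductive step_kind := Ctl | Sys.

Section Semantics.
Variables (Sg : signature) (Lbl Nm : Type).
Variable (R : rewrite_theory Sg Lbl).
Variable (D : set (strategy_def Sg Lbl Nm)).
Local Notation var := (var Sg).
Local Notation term := (term Sg).
Local Notation atom := (atom Sg).
Local Notation substitution := (substitution Sg).
Local Notation strategy := (strategy Sg Lbl Nm).
Local Notation stack := (stack Sg Lbl Nm).
Local Notation xstate := (xstate Sg Lbl Nm).

(** ** Deduction and terms modulo the axioms *)

(* Deduction over the kinded variables [X]; [X] is made explicit because the
   sorts and kinds of a signature may be empty. *)
Inductive deduce (X : seq var) : atom -> Prop :=
  | ded_refl t k :
      wk X t k -> deduce X (Eqn t t)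
  | ded_sym t u :
      deduce X (Eqn t u) -> deduce X (Eqn u t)
  | ded_trans t u v :
      deduce X (Eqn t u) -> deduce X (Eqn u v) -> deduce X (Eqn t v)
  | ded_cong f ts us k :
      wk X (App f ts) k ->
      List.Forall2 (fun t u => deduce X (Eqn t u)) ts us ->
      deduce X (Eqn (App f ts) (App f us))
  | ded_mem t u s :
      deduce X (Eqn t u) -> deduce X (Mem u s) -> deduce X (Mem t s)
  | ded_axiom e g :
      axioms R e ->
      (forall x, x \in svars e -> wk X (g x) (vkind x)) ->
      List.Forall (deduce X) (map (asubst g) (sort_conds (svars e) ++ premises e)) ->
      deduce X (asubst g (concl e)).

Lemma canon_subproof X (t : term) : exists u, t = u \/ deduce X (Eqn t u).
Proof. by exists t; left. Qed.

(* A class of terms over [X] modulo the axioms is represented by one of its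
   members, chosen once and for all; see [canonE]. Ill-kinded terms are only
   equal to themselves. *)
Definition canon (X : seq var) (t : term) : term :=
  sval (cid (canon_subproof X t)).

Lemma canonE X t u k :
  wk X t k -> canon X t = canon X u <-> deduce X (Eqn t u).
Proof.
move=> tk; split=> [|tu].
  rewrite /canon; case: cid => c /= tc; case: cid => d /= ud cd.
  subst d; case: tc ud => [<-|tc] [ut|ut].
  - by rewrite ut; exact: ded_refl tk.
  - exact: ded_sym.
  - by rewrite ut.
  - exact: ded_trans tc (ded_sym ut).
have E : (fun v => t = v \/ deduce X (Eqn t v)) =
         (fun v => u = v \/ deduce X (Eqn u v)).
  rewrite predeqE => v; split=> [[<-|tv]|[<-|uv]]; right=> //.
  - exact: ded_sym.
  - exact: ded_trans (ded_sym tu) tv.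
  - exact: ded_trans tu uv.
rewrite /canon; move: (canon_subproof X t) (canon_subproof X u).
by rewrite E => p q; rewrite (Prop_irrelevance p q).
Qed.

(** ** Contexts and one-step rewriting *)

Definition hole (k : kind Sg) : var := (0, inr k).

(* A context is a term in which the hole occurs exactly once and which has no
   other variable. *)
Definition context (k : kind Sg) (c : term) : Prop :=
  tkind c <> None /\ tvars c = [:: hole k].

(* Contexts and their representatives contain no variable but the hole. *)
Definition plug (c u : term) : term := subst (fun=> u) c.

Definition canon_ctx (k : kind Sg) (c : term) : term := canon [:: hole k] c.

(* [c] is a position where a rule with left-hand side [l] may be applied. *)
Definition at_position (top : bool) (l : term) (k : kind Sg) (c : term) : Prop :=
  [/\ context k c, tkind l = Some k & top -> c = Var (hole k)].

Definition rvars (r : rule Sg Lbl) : seq var :=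
  tvars (lhs r) ++ tvars (rhs r) ++ fragvars (rcond r).

(* One-step rewriting, where rewriting conditions are solved by rewriting in
   any number of steps. *)
Inductive rew1 : bool -> term -> term -> Prop :=
  | rew1_rule top r g k c t t' :
      rules R r ->
      at_position top (lhs r) k c ->
      (forall x, x \in rvars r -> wk [::] (g x) (vkind x)) ->
      List.Forall (deduce [::]) (map (asubst g) (sort_conds (rvars r))) ->
      (forall a, List.In (FAtom a) (rcond r) -> deduce [::] (asubst g a)) ->
      (forall l p, List.In (FRew l p) (rcond r) -> rews (subst g l) (subst g p)) ->
      deduce [::] (Eqn t (plug c (subst g (lhs r)))) ->
      deduce [::] (Eqn (plug c (subst g (rhs r))) t') ->
      rew1 top t t'
with rews : term -> term -> Prop :=
  | rews_eq t u : deduce [::] (Eqn t u) -> rews t u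
  | rews_step t u v : rew1 false t u -> rews u v -> rews t v.

(** ** Substitutions and matching *)

Definition empty_subst : substitution := fun=> None.

Definition total (th : substitution) : var -> term :=
  fun x => odflt (Var x) (th x).

Definition app (th : substitution) (t : term) : term := subst (total th) t.

(* The class of a ground instance. *)
Definition inst (th : substitution) (t : term) : term := canon [::] (app th t).

Definition without (th : substitution) (X : seq var) : substitution :=
  fun x => if x \in X then None else th x.

Definition assoc (T : Type) (xs : seq (var * T)) (x : var) : option T :=
  ohead (pmap (fun y => if y.1 == x then Some y.2 else None) xs).

Definition inst_init (th : substitution) (rho : seq (var * term)) : substitution :=
  assoc [seq (y.1, inst th y.2) | y <- rho].

(* Values are ground terms (modulo the axioms) of the kind, and of the sort if
   any, of the variable. *)
Definition wf_subst (sg : substitution) : Prop :=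
  forall x u, sg x = Some u ->
    [/\ wk [::] u (vkind x), canon [::] u = u
      & forall s, x.2 = inl s -> deduce [::] (Mem u s)].

(* [sg] extends [th] and is exactly defined on the domain of [th] and [X]. *)
Definition extension (th : substitution) (X : seq var) (sg : substitution) : Prop :=
  [/\ wf_subst sg,
      forall x u, th x = Some u -> sg x = Some u
    & forall x, isSome (sg x) = isSome (th x) || (x \in X)].

Definition satisfies (sg : substitution) (C : seq atom) : Prop :=
  List.Forall (deduce [::]) (map (asubst (total sg)) C).

Definition atoms_vars (C : seq atom) : seq var := flatten (map (@avars Sg) C).

Definition associative_op (f : op Sg) : Prop :=
  exists k, let x i : term := Var (i, inr k) in
    [/\ arity f = [:: k; k], cokind f = k
      & deduce [:: (0, inr k); (1, inr k); (2, inr k)]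
          (Eqn (App f [:: App f [:: x 0; x 1]; x 2])
               (App f [:: x 0; App f [:: x 1; x 2]]))].

(* Matching with extension: when the top symbol of the pattern is associative,
   the pattern may match a fragment of the flattened argument list. *)
Definition extension_ctx (P : term) (k : kind Sg) (c : term) : Prop :=
  c = Var (hole k) \/
  exists f ts, [/\ P = App f ts, associative_op f &
    (exists u, c = App f [:: u; Var (hole k)]) \/
    (exists v, c = App f [:: Var (hole k); v]) \/
    (exists u v, c = App f [:: u; App f [:: Var (hole k); v]])].

Definition match_ctx (m : mmode) (P : term) (k : kind Sg) (c : term) : Prop :=
  context k c /\
  match m with
  | AtRoot => c = Var (hole k)
  | WithExtension => extension_ctx P k c
  | Anywhere => True
  end.

(* [t] matches [P] inside the context [c] by [sg], which satisfies [C] and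
   extends [th]. *)
Definition matches (m : mmode) (th : substitution) (P : term) (C : seq atom)
    (t c : term) (sg : substitution) : Prop :=
  [/\ exists2 k, match_ctx m P k c & tkind P = Some k,
      extension th (tvars P ++ atoms_vars C) sg,
      satisfies sg C
    & t = canon [::] (plug c (app sg P))].

(** ** Transitions *)

Fixpoint vctx (s : stack) : substitution :=
  match s with
  | [::] => empty_subst
  | inr th :: _ => th
  | inl _ :: s' => vctx s'
  end.

(* A call replaces the substitution on top of the stack, if any. *)
Definition push_call (sg : substitution) (s : stack) : stack :=
  if s is inr _ :: s' then inr sg :: s' else inr sg :: s.

Fixpoint cterm (q : xstate) : term :=
  match q with
  | XT t _ => t
  | XSub xqs t _ =>
      inst (assoc (map (fun xq => (xq.1, cterm xq.2)) xqs)) t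
  | XRewc _ _ _ _ _ _ _ _ t _ => t
  end.

(* The transitions, for a given meaning [failed] of the negative premise of the
   conditional. *)
Inductive step_with (failed : set xstate) : step_kind -> xstate -> xstate -> Prop :=
  | st_idle t s :
      step_with failed Ctl (XT t (inl Idle :: s)) (XT t s)
  | st_pop t th s :
      step_with failed Ctl (XT t (inr th :: s)) (XT t s)
  | st_match m P C t s c sg :
      matches m (vctx s) P C t c sg ->
      step_with failed Ctl (XT t (inl (Match m P C) :: s)) (XT t s)
  | st_seq a b t s :
      step_with failed Ctl (XT t (inl (Seq a b) :: s)) (XT t [:: inl a, inl b & s])
  | st_alt_l a b t s :
      step_with failed Ctl (XT t (inl (Alt a b) :: s)) (XT t (inl a :: s))
  | st_alt_r a b t s :
      step_with failed Ctl (XT t (inl (Alt a b) :: s)) (XT t (inl b :: s))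
  | st_star_stop a t s :
      step_with failed Ctl (XT t (inl (Star a) :: s)) (XT t s)
  | st_star_iter a t s :
      step_with failed Ctl (XT t (inl (Star a) :: s))
        (XT t [:: inl a, inl (Star a) & s])
  | st_cond_then a b c t s :
      step_with failed Ctl (XT t (inl (Cond a b c) :: s))
        (XT t [:: inl a, inl b & s])
  | st_cond_else a b c t s :
      failed (XT t [:: inl a; inr (vctx s)]) ->
      step_with failed Ctl (XT t (inl (Cond a b c) :: s)) (XT t (inl c :: s))
  | st_all top t t' s :
      rew1 top t t' ->
      step_with failed Sys (XT t (inl (All top) :: s)) (XT (canon [::] t') s)
  | st_rule top rl rho r C k c sg t s :
      rules R r -> rlabel r = rl -> rcond r = map (@FAtom Sg) C ->
      at_position top (lhs r) k c ->
      extension (inst_init (vctx s) rho) (rvars r) sg ->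
      satisfies sg C ->
      t = canon [::] (plug c (app sg (lhs r))) ->
      step_with failed Sys (XT t (inl (Rl top rl rho [::]) :: s))
        (XT (canon [::] (plug c (app sg (rhs r)))) s)
  | st_rewc_start top rl rho a al r C0 l p C k c sg t s :
      rules R r -> rlabel r = rl ->
      rcond r = map (@FAtom Sg) C0 ++ FRew l p :: C ->
      count (@is_rew Sg) (rcond r) = size (a :: al) ->
      at_position top (lhs r) k c ->
      extension (inst_init (vctx s) rho)
        (tvars (lhs r) ++ atoms_vars C0 ++ tvars l) sg ->
      satisfies sg C0 ->
      t = canon [::] (plug c (app sg (lhs r))) ->
      step_with failed Ctl (XT t (inl (Rl top rl rho (a :: al)) :: s))
        (XRewc p (XT (inst sg l) [:: inl a; inr (vctx s)]) sg C al (vctx s)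
           (rhs r) (canon_ctx k c) t s)
  | st_rewc_inner lb p q q' sg C al th r c t s :
      step_with failed lb q q' ->
      step_with failed Ctl (XRewc p q sg C al th r c t s)
        (XRewc p q' sg C al th r c t s)
  | st_rewc_next p t' sg C0 l p' C a al th r c t s sg' :
      extension sg (tvars p ++ atoms_vars C0 ++ tvars l) sg' ->
      inst sg' p = t' ->
      satisfies sg' C0 ->
      step_with failed Ctl
        (XRewc p (XT t' [::]) sg (map (@FAtom Sg) C0 ++ FRew l p' :: C)
           (a :: al) th r c t s)
        (XRewc p' (XT (inst sg' l) [:: inl a; inr th]) sg' C al th r c t s)
  | st_rewc_end p t' sg C0 al th r c t s sg' :
      extension sg (tvars p ++ atoms_vars C0 ++ tvars r) sg' ->
      inst sg' p = t' ->
      satisfies sg' C0 ->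
      step_with failed Sys
        (XRewc p (XT t' [::]) sg (map (@FAtom Sg) C0) al th r c t s)
        (XT (canon [::] (plug c (app sg' r))) s)
  | st_matchrew m P C xas t s c sg :
      matches m (vctx s) P C t c sg ->
      step_with failed Ctl (XT t (inl (Matchrew m P C xas) :: s))
        (XSub [seq (xa.1, XT (inst sg (Var xa.1)) [:: inl xa.2; inr sg]) | xa <- xas]
           (canon (unzip1 xas) (plug c (app (without sg (unzip1 xas)) P))) s)
  | st_sub_inner lb xqs1 x q q' xqs2 t s :
      step_with failed lb q q' ->
      step_with failed lb (XSub (xqs1 ++ (x, q) :: xqs2) t s)
        (XSub (xqs1 ++ (x, q') :: xqs2) t s)
  | st_sub_end (xts : seq (var * term)) t s :
      step_with failed Ctl (XSub [seq (xt.1, XT xt.2 [::]) | xt <- xts] t s)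
        (XT (inst (assoc xts) t) s)
  | st_call sl ts d sg t s :
      D d -> dname d = sl ->
      List.Forall (fun u => ground (app (vctx s) u)) ts ->
      extension empty_subst
        (flatten (map (@tvars Sg) (dparams d)) ++ atoms_vars (dcond d)) sg ->
      map (inst sg) (dparams d) = map (inst (vctx s)) ts ->
      satisfies sg (dcond d) ->
      step_with failed Ctl (XT t (inl (Call sl ts) :: s))
        (XT t (inl (dbody d) :: push_call sg s)).

Definition step_any_with failed (q q' : xstate) : Prop :=
  exists lb, step_with failed lb q q'.

Definition terminating (T : Type) (S : T -> T -> Prop) (q : T) : Prop :=
  ~ exists f : nat -> T, f 0 = q /\ forall n, S (f n) (f n.+1).

Definition fails_under (failed : set xstate) : set xstate :=
  [set q | terminating (step_any_with failed) q /\
     ~ exists t, clos_refl_trans _ (step_any_with failed) q (XT t [::])].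

(* The transitions are specified by rules one of which has a negative premise
   about the transitions themselves. They are given their well-founded model:
   [failed] is the least fixed point of the monotone operator
   [fails_under \o fails_under]. By [failedE] it satisfies the intended
   equation, of which it is the only solution by [failed_unique]. *)
Definition failed : set xstate :=
  [set q | forall P, fails_under (fails_under P) `<=` P -> P q].

Definition step : step_kind -> xstate -> xstate -> Prop := step_with failed.

Definition step_any (q q' : xstate) : Prop := exists lb, step lb q q'.

(** ** Denotation *)

Definition big_step (q q' : xstate) : Prop :=
  exists2 q1, clos_refl_trans _ (step Ctl) q q1 & step Sys q1 q'.

Definition start (a : strategy) (t : term) : xstate :=
  XT (canon [::] t) [:: inl a].

Definition reachable (a : strategy) (t : term) : set xstate :=
  [set q | clos_refl_trans _ step_any (start a t) q].

Definition Ex_fin (a : strategy) (t : term) : set (word xstate) :=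
  [set w | exists (n : nat) (q : nat -> xstate),
     [/\ w = Fin (mkseq q n.+1), q 0 = start a t,
         forall k, k < n -> big_step (q k) (q k.+1)
       & exists2 t', ground t' & clos_refl_trans _ (step Ctl) (q n) (XT t' [::])]].

Definition Ex_inf (a : strategy) (t : term) : set (word xstate) :=
  [set w | exists q : nat -> xstate,
     [/\ w = Inf q, q 0 = start a t & forall k, big_step (q k) (q k.+1)]].

Definition denotation (a : strategy) (t : term) : set (word term) :=
  wmap cterm @` (Ex_fin a t `|` Ex_inf a t).

(** ** The negative premise is well defined *)

Lemma step_with_mono F G lb q q' :
  F `<=` G -> step_with F lb q q' -> step_with G lb q q'.
Proof.
by move=> FG; elim=> *; econstructor; eauto.
Qed.

Lemma path_mono (T : Type) (S S' : T -> T -> Prop) x y :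
  (forall x y, S x y -> S' x y) -> clos_refl_trans _ S x y -> clos_refl_trans _ S' x y.
Proof.
move=> SS'; elim=> [u v /SS' ?|u|u v w _ uv _ vw];
  [exact: rt_step|exact: rt_refl|exact: rt_trans uv vw].
Qed.

Lemma fails_under_anti F G : F `<=` G -> fails_under G `<=` fails_under F.
Proof.
move=> FG q [qt qs].
have S x y : step_any_with F x y -> step_any_with G x y.
  by move=> [lb xy]; exists lb; apply: step_with_mono xy.
split=> [[f [f0 fS]]|[t qt']].
  by apply: qt; exists f; split=> // n; apply: S.
by apply: qs; exists t; apply: path_mono qt'.
Qed.

(* [ssim s s']: [s] behaves as [s'] until it is exhausted. *)
Inductive ssim : stack -> stack -> Prop :=
  | ssim_ctx a s : ssim [:: inr (vctx (inl a :: s))] (inl a :: s)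
  | ssim_sub th s : ssim [:: inr th] (inr th :: s)
  | ssim_cons e s1 s2 : s1 <> [::] -> ssim s1 s2 -> ssim (e :: s1) (e :: s2).

(* A state also simulates its inner states. *)
Inductive sim1 : xstate -> xstate -> Prop :=
  | sim_refl q : sim1 q q
  | sim_T t s1 s2 : ssim s1 s2 -> sim1 (XT t s1) (XT t s2)
  | sim_Sub xqs t s1 s2 : ssim s1 s2 -> sim1 (XSub xqs t s1) (XSub xqs t s2)
  | sim_Rewc p q sg C al th r c t s1 s2 : ssim s1 s2 ->
      sim1 (XRewc p q sg C al th r c t s1) (XRewc p q sg C al th r c t s2)
  | sim_in_Sub q0 xqs1 x q xqs2 t s : sim1 q0 q ->
      sim1 q0 (XSub (xqs1 ++ (x, q) :: xqs2) t s)
  | sim_in_Rewc q0 p q sg C al th r c t s : sim1 q0 q ->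
      sim1 q0 (XRewc p q sg C al th r c t s).

Definition sim := clos_trans xstate sim1.

Lemma ssim_vctx s1 s2 : ssim s1 s2 -> vctx s1 = vctx s2.
Proof. by elim=> // -[?|?] *. Qed.

Lemma ssim_push sg s1 s2 : ssim s1 s2 -> ssim (push_call sg s1) (push_call sg s2).
Proof.
case=> [a s|th s|[e|e] u1 u2 u1N u12]; try exact: ssim_sub.
  by apply: ssim_cons => //; apply: ssim_cons.
by apply: ssim_cons.
Qed.

Lemma push_callN sg s : push_call sg s <> [::].
Proof. by case: s => [|[?|?] ?]. Qed.

Lemma ssim_step F lb t s1 s2 q' :
    step_with F lb (XT t s1) q' -> ssim s1 s2 ->
  (exists2 q'', step_with F lb (XT t s2) q'' & sim1 q' q'') \/
  exists u, q' = XT u [::].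
Proof.
move=> st ss; inversion st; subst; inversion ss; subst;
  try (by right; eexists); left;
  match goal with H : ssim _ _, K : ssim _ _ |- _ =>
    have V := ssim_vctx K; clear H end.
all: match type of V with ?x = _ => remember x as theta eqn:E; clear E; subst theta end.
all: by eexists;
  [ econstructor; eauto
  | first [ exact: sim_Rewc | exact: sim_Sub
    | apply: sim_T; repeat (apply: ssim_cons => //; try exact: push_callN);
      first [assumption | exact: ssim_push] ] ].
Qed.

Lemma sim1_step F lb a a' b : step_with F lb a a' -> sim1 a b ->
  (exists2 b', step_any_with F b b' & sim1 a' b') \/ exists u, a' = XT u [::].
Proof.
move=> st ab; elim: ab lb a' st => {a b}.
- by move=> q lb a' st; left; exists a'; [exists lb|exact: sim_refl].
- move=> t s1 s2 ss lb a' st.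
  by case: (ssim_step st ss) => [[b' sb ab]|]; [left; exists b' => //; exists lb|right].
- move=> xqs t s1 s2 ss lb a' st; inversion st; subst; left.
  + by eexists; [eexists; apply: st_sub_inner; eassumption|exact: sim_Sub].
  + by eexists; [eexists; apply: st_sub_end|exact: sim_T].
- move=> p q sg C al th r c t s1 s2 ss lb a' st; inversion st; subst; left.
  + by eexists; [eexists; apply: st_rewc_inner; eassumption|exact: sim_Rewc].
  + by eexists; [eexists; apply: st_rewc_next; eauto|exact: sim_Rewc].
  + by eexists; [eexists; apply: st_rewc_end; eauto|exact: sim_T].
- move=> q0 xqs1 x q xqs2 t s _ IH lb a' /IH [[b' [lb' sb] ab]|]; last by right.
  by left; eexists; [exists lb'; apply: st_sub_inner; eassumption|exact: sim_in_Sub].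
- move=> q0 p q sg C al th r c t s _ IH lb a' /IH [[b' [lb' sb] ab]|]; last by right.
  by left; eexists; [exists Ctl; apply: st_rewc_inner; eassumption|exact: sim_in_Rewc].
Qed.

Lemma sim_nil a b u : sim a b -> b = XT u [::] -> a = b.
Proof.
have nil1 c d : sim1 c d -> d = XT u [::] -> c = d.
  by case=> // t s1 s2 ss [_ s2E]; subst s2; inversion ss.
elim=> {a b} [a b ab bu|a b c _ ab _ bc cu]; first exact: nil1 ab bu.
by rewrite -(bc cu); apply: ab; rewrite (bc cu).
Qed.

Lemma sim_step F a b : sim a b -> forall a', step_any_with F a a' ->
  (exists2 b', step_any_with F b b' & sim a' b') \/ exists u, a' = XT u [::].
Proof.
elim=> {a b} [a b ab a' [lb st]|a b c _ IHab _ IHbc a' /IHab].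
  case: (sim1_step st ab) => [[b' bb' ab']|]; last by right.
  by left; exists b' => //; apply: t_step.
case=> [[b' /IHbc bb' ab']|]; last by right.
case: bb' => [[c' cc' bc']|[u b'E]]; last by right; exists u; rewrite (sim_nil ab' b'E).
by left; exists c' => //; apply: t_trans bc'.
Qed.

Lemma terminating_acc (T : Type) (S : T -> T -> Prop) q :
  terminating S q -> Acc (fun y x => S x y) q.
Proof.
move=> tq; apply: contrapT => nq; apply: tq.
have ex (x : {x | ~ Acc (fun y x => S x y) x}) :
    exists y : {x | ~ Acc (fun y x => S x y) x}, S (sval x) (sval y).
  apply: contrapT => H; case: (svalP x); constructor=> y xy.
  by apply: contrapT => ny; apply: H; exists (exist _ y ny).
pose f n := iter n (fun x => sval (cid (ex x))) (exist _ q nq).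
by exists (sval \o f); split=> // n /=; case: cid.
Qed.

Lemma sim_path F a b : sim a b -> forall a',
  clos_refl_trans _ (step_any_with F) a a' ->
  (exists2 b', clos_refl_trans _ (step_any_with F) b b' & sim a' b') \/
  exists u, a' = XT u [::].
Proof.
move=> ab a' aa'.
elim: {a' aa'} (Operators_Properties.clos_rt_rtn1 _ _ _ _ aa') => [|x y xy _ IH].
  by left; exists b => //; apply: rt_refl.
case: IH => [[b' bb' xb']|[u xE]]; last by case: xy => lb; rewrite xE => st; inversion st.
case: (sim_step xb' xy) => [[b'' bb'' yb'']|]; last by right.
by left; exists b'' => //; apply: rt_trans bb' _; apply: rt_step.
Qed.

(* The else branch of a conditional only matters in terminating states, where
   its condition is simulated by the then branch. *)
Lemma step_fails_under F : fails_under (fails_under F) `<=` F ->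
  forall q, Acc (fun y x => step_any_with F x y) q ->
  forall q', clos_refl_trans _ (step_any_with F) q q' ->
  forall a, sim a q' -> forall lb a',
  step_with (fails_under F) lb a a' -> step_with F lb a a'.
Proof.
move=> FF q; elim=> {}q _ IH q' qq'.
case: {q' qq'} (Operators_Properties.clos_rt_rt1n _ _ _ _ qq') => [|q1 q2 qq1 q12]; last first.
  exact: IH qq1 _ (Operators_Properties.clos_rt1n_rt _ _ _ _ q12).
move=> a aq lb a' st; elim: st aq => {a lb a'}; try by move=> *; econstructor; eauto.
- move=> a b c t s [xt xs] aq; apply: st_cond_else; apply: FF.
  set x := XT t _ in xt xs *.
  have st : step_with F Ctl (XT t (inl (Cond a b c) :: s)) (XT t [:: inl a, inl b & s]).
    exact: st_cond_then.
  case: (sim_step aq (ex_intro _ _ st)) => [[q1 qq1 tq1]|[? []//]].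
  have xq1 : sim x q1.
    by apply: t_trans tq1; apply: t_step; apply: sim_T; apply: ssim_cons => //;
      exact: ssim_ctx.
  have agree y y' : clos_refl_trans _ (step_any_with F) x y ->
      step_any_with (fails_under F) y y' -> step_any_with F y y'.
    move=> xy [lb yy']; case: (sim_path xq1 xy) => [[z q1z yz]|[u yE]].
      by exists lb; apply: IH qq1 _ q1z _ yz _ _ yy'.
    by rewrite yE in yy'; inversion yy'.
  split=> [[f [f0 fS]]|[u xu]].
    apply: xt; exists f; split=> //.
    suff H n : clos_refl_trans _ (step_any_with F) x (f n) by move=> n; apply: agree.
    elim: n => [|n IHn]; first by rewrite f0; apply: rt_refl.
    by apply: (rt_trans _ _ _ _ _ IHn); apply: rt_step; apply: agree.
  apply: xs; exists u.
  elim: (Operators_Properties.clos_rt_rtn1 _ _ _ _ xu) => [|y z yz _ xy].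
    exact: rt_refl.
  by apply: (rt_trans _ _ _ _ _ xy); apply: rt_step; apply: agree.
- move=> lb p q0 q1 sg C al th r c t s _ IHq aq; apply: st_rewc_inner.
  apply: IHq; apply: t_trans aq; apply: t_step.
  by apply: sim_in_Rewc; exact: sim_refl.
- move=> lb xqs1 x q0 q1 xqs2 t s _ IHq aq; apply: st_sub_inner.
  apply: IHq; apply: t_trans aq; apply: t_step.
  by apply: sim_in_Sub; exact: sim_refl.
Qed.

Lemma fails_under2_sub F : fails_under (fails_under F) `<=` F ->
  fails_under F `<=` F.
Proof.
move=> FF x [xt xs]; apply: (FF).
have agree y y' : clos_refl_trans _ (step_any_with F) x y ->
    step_any_with (fails_under F) y y' -> step_any_with F y y'.
  move=> xy [lb yy']; exists lb.
  apply: (step_fails_under FF (terminating_acc xt) xy _ yy').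
  by apply: t_step; apply: sim_refl.
split=> [[f [f0 fS]]|[u xu]].
  apply: xt; exists f; split=> //.
  suff H n : clos_refl_trans _ (step_any_with F) x (f n) by move=> n; apply: agree.
  elim: n => [|n IHn]; first by rewrite f0; apply: rt_refl.
  by apply: (rt_trans _ _ _ _ _ IHn); apply: rt_step; apply: agree.
apply: xs; exists u.
elim: (Operators_Properties.clos_rt_rtn1 _ _ _ _ xu) => [|y z yz _ xy].
  exact: rt_refl.
by apply: (rt_trans _ _ _ _ _ xy); apply: rt_step; apply: agree.
Qed.

Lemma failedE : failed = fails_under failed.
Proof.
have low P : fails_under (fails_under P) `<=` P -> failed `<=` P.
  by move=> PP q; apply.
have pre : fails_under (fails_under failed) `<=` failed.
  move=> q qf P PP; apply: (PP); move: qf; apply: fails_under_anti.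
  by apply: fails_under_anti; exact: low.
have sub : fails_under failed `<=` failed by exact: fails_under2_sub.
apply/seteqP; split=> //.
apply: (low); apply: fails_under_anti; apply: (low).
by apply: fails_under_anti; exact: fails_under_anti pre.
Qed.

Lemma failed_unique F : F = fails_under F -> F = failed.
Proof.
move=> FE.
have low : failed `<=` F by move=> q; apply; rewrite -!FE.
by apply/seteqP; split=> //; rewrite FE failedE; exact: fails_under_anti.
Qed.

End Semantics.

(* Main.v *)
Require Import Defs.
From mathcomp Require Import all_boot.
From mathcomp Require Import boolp classical_sets cardinality.
From Stdlib Require List.
From Stdlib Require Import Relation_Operators.

(** The denotation is the set of traces of the transition system of the big
    steps, which stays among the finitely many reachable states. Hence these
    states form a finite automaton for the finite words and, as no acceptance
    condition bears on infinite executions, a Büchi automaton without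
    acceptance condition for the infinite ones. The latter contain their
    accumulation points by König's lemma. *)

Set Implicit Arguments.
Unset Strict Implicit.
Unset Printing Implicit Defensive.

Local Open Scope classical_set_scope.

(** The states of an automaton must form a [finType], hence the indices in ['I_n]; [{classic T}]
    supplies the decidable equality that [T] lacks. *)
Lemma finite_set_cover (T : Type) (V : set T) :
  finite_set V -> exists n (f : 'I_n -> T), V `<=` range f.
Proof.
move=> /(@finite_seqP {classic T})[s ->].
exists (size s), (tnth (in_tuple s)) => x /= /(tnthP (in_tuple s))[i ->].
by exists i.
Qed.

Lemma mkseq_recl (T : Type) (q : nat -> T) n :
  mkseq q n.+1 = q 0 :: mkseq (q \o succn) n.
Proof. by rewrite /mkseq /= (iotaDl 1 0) -map_comp. Qed.

Lemma Forall_mkseq (T : Type) (P : T -> Prop) (q : nat -> T) n :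
  (forall k, k < n -> P (q k)) -> List.Forall P (mkseq q n).
Proof.
elim: n q => [|n IH] q qP; first exact: List.Forall_nil.
rewrite mkseq_recl; constructor; first exact: qP.
by apply: IH => k; exact: (qP k.+1).
Qed.

Section Traces.
Variables (Q A : Type) (lab : Q -> A) (B : Q -> Q -> Prop) (q0 : Q) (F : set Q).

Definition fin_runs : set (word Q) :=
  [set w | exists (n : nat) (q : nat -> Q),
     [/\ w = Fin (mkseq q n.+1), q 0 = q0,
         forall k, k < n -> B (q k) (q k.+1) & F (q n)]].

Definition inf_runs : set (word Q) :=
  [set w | exists q : nat -> Q,
     [/\ w = Inf q, q 0 = q0 & forall k, B (q k) (q k.+1)]].

(** The shape of [denotation], which unfolds to it for [lab := cterm], [B := big_step] and a
    suitable [F]. *)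
Definition traces : set (word A) := wmap lab @` (fin_runs `|` inf_runs).

Lemma traces_FinP u : traces (Fin u) <-> exists n (q : nat -> Q),
  [/\ u = map lab (mkseq q n.+1), q 0 = q0,
      forall k, k < n -> B (q k) (q k.+1) & F (q n)].
Proof.
split=> [[_ [[n [q [-> q00 qB qF]]]|[q [-> _ _]]] //= [<-]]|].
  by exists n, q.
move=> [n [q [-> q00 qB qF]]]; exists (Fin (mkseq q n.+1)) => //.
by left; exists n, q.
Qed.

Lemma traces_InfP w : traces (Inf w) <-> exists q : nat -> Q,
  [/\ w = lab \o q, q 0 = q0 & forall k, B (q k) (q k.+1)].
Proof.
split=> [[_ [[n [q [-> _ _ _]]]|[q [-> q00 qB]]] //= [<-]]|].
  by exists q.
by move=> [q [-> q00 qB]]; exists (Inf q) => //; right; exists q.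
Qed.

(** The run [p] may change with [n]: these are only finite approximations of an infinite run reading
    [w] from position [m] on. *)
Definition live (w : nat -> A) (m : nat) (q : Q) : Prop := forall n,
  exists p : nat -> Q, [/\ p 0 = q, forall k, k < n -> B (p k) (p k.+1)
    & forall k, k <= n -> lab (p k) = w (m + k)].

Lemma accumulation_live w : accumulation_point traces w -> live w 0 q0.
Proof.
move=> acc n; have [_ [v vr <-]] := acc n.+1.
case: vr => [[m [q [-> q00 qB _]]]|[q [-> q00 qB]]]; rewrite /wmap /wprefix => E.
  (* The word has only [m.+1] letters and its [take] must have [n.+1]. *)
  have nm : n <= m.
    move/(congr1 size): E; rewrite size_take size_map !size_mkseq.
    by case: ltnP => [/ltnW|_ []->].
  exists q; split=> // [k kn|k kn]; first exact: qB (leq_trans kn nm).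
  move/(congr1 (nth (w 0) ^~ k)): E.
  by rewrite nth_take // (nth_map q0) ?size_mkseq ?nth_mkseq // ltnS (leq_trans kn).
exists q; split=> // k kn; move/(congr1 (nth (w 0) ^~ k)): E.
by rewrite !nth_mkseq.
Qed.

Section FiniteStates.
Variables (I : finType) (f : I -> Q) (V : set Q).
Hypotheses (fV : V `<=` range f) (V0 : V q0).
Hypothesis VB : forall q q', V q -> B q q' -> V q'.

(** The pigeonhole step of König's lemma. If no successor were live, each [f i] that is a successor
    would have a length [N i] for which no run from it reads [w]; a run from [q] longer than all of
    these passes through one of them. *)
Lemma live_step w m q : V q -> live w m q ->
  lab q = w m /\ exists q', [/\ V q', B q q' & live w m.+1 q'].
Proof.
move=> qV ql; split; first by have [p [<- _ /(_ 0)->]] := ql 0; rewrite ?addn0.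
apply: contrapT => nq.
have ex i : exists n, B q (f i) -> ~ exists p : nat -> Q,
    [/\ p 0 = f i, forall k, k < n -> B (p k) (p k.+1)
      & forall k, k <= n -> lab (p k) = w (m.+1 + k)].
  have [qi|nqi] := pselect (B q (f i)); last by exists 0.
  apply: contrapT => nn; apply: nq; exists (f i); split=> //; first exact: VB qi.
  by move=> n; apply: contrapT => np; apply: nn; exists n.
pose N i := sval (cid (ex i)).
(* The extra step is the one from [q] to [p 1]; the remaining ones suffice for [N i]. *)
have [p [p0 pB pw]] := ql (\max_i N i).+1.
have qp : B q (p 1) by rewrite -p0; exact: pB.
have [i _ fi] := fV (VB qV qp).
have Ni : N i <= \max_i N i by exact: leq_bigmax.
move: (svalP (cid (ex i))); rewrite -/(N i) fi => /(_ qp); apply.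
exists (fun k => p k.+1); split=> // k kN.
  by apply: pB; rewrite ltnS (leq_trans kN).
by rewrite pw ?addnS ?addSn // ltnS (leq_trans kN).
Qed.

(** Iterating [live_step] builds the infinite run. Positions are stored next to states, so that all
    choices are made in the single type [X]. *)
Lemma traces_closed : closed_language traces.
Proof.
move=> w /accumulation_live q0l.
pose X := {mq : nat * Q | V mq.2 /\ live w mq.1 mq.2}.
have ex (x : X) : exists y : X,
    (sval y).1 = (sval x).1.+1 /\ B (sval x).2 (sval y).2.
  case: x => -[m q] /= [qV ql]; have [_ [q' [qV' qq' ql']]] := live_step qV ql.
  by exists (exist _ (m.+1, q') (conj qV' ql')).
pose x n : X := iter n (fun x => sval (cid (ex x))) (exist _ (0, q0) (conj V0 q0l)).
have xS n : (sval (x n.+1)).1 = (sval (x n)).1.+1 /\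
    B (sval (x n)).2 (sval (x n.+1)).2.
  exact: svalP (cid (ex (x n))).
have xn n : (sval (x n)).1 = n by elim: n => // n IH; rewrite (xS n).1 IH.
apply/traces_InfP; exists (fun n => (sval (x n)).2); split=> // [|n].
  apply/funext => n /=; have [V_n l_n] := svalP (x n).
  by rewrite (live_step V_n l_n).1 xn.
exact: (xS n).2.
Qed.

(* Reading the last letter of a finite word leads to [None]. *)
Definition trace_trans (p : option I) (a : A) : set (option I) :=
  [set p' | if p is Some i then a = lab (f i) /\
     (if p' is Some j then B (f i) (f j) else F (f i)) else False].

Definition trace_init : set (option I) :=
  [set p | if p is Some i then f i = q0 else False].

Definition fin_automaton : automaton A :=
  Automaton trace_init trace_trans [set None].

(** [None] has no successor, so an infinite run stays in states [Some i] and the Büchi condition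
    always holds. *)
Definition inf_automaton : automaton A :=
  Automaton trace_init trace_trans [set p | isSome p].

Lemma accepts_from_run (i : I) (u : seq A) :
  @accepts_from A fin_automaton (Some i) u -> exists n (q : nat -> Q),
  [/\ u = map lab (mkseq q n.+1), q 0 = f i,
      forall k, k < n -> B (q k) (q k.+1) & F (q n)].
Proof.
elim: u i => [|a u IH] i // [[j|] [-> ij]] => [/IH[n [q [-> q0j qB qF]]]|].
  exists n.+1, (fun k => if k is k'.+1 then q k' else f i); split=> //.
  - by rewrite (mkseq_recl _ n.+1).
  - by case=> [|k] /=; rewrite ?q0j // ltnS; exact: qB.
(* After the move to [None] nothing more can be read, so [a] was the last letter. *)
by case: u {IH} => [_|? ? [? []]//]; exists 0, (fun=> f i).
Qed.

Lemma run_accepts_from n (q : nat -> Q) (i : I) : V (q 0) -> q 0 = f i ->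
  (forall k, k < n -> B (q k) (q k.+1)) -> F (q n) ->
  @accepts_from A fin_automaton (Some i) (map lab (mkseq q n.+1)).
Proof.
elim: n q i => [|n IH] q i qV qi qB qF; rewrite mkseq_recl /=.
  by exists None => //; rewrite /trace_trans /= -qi.
have qV1 : V (q 1) by apply: VB (qB 0 _).
have [j _ qj] := fV qV1.
exists (Some j); first by rewrite /trace_trans /= -qi qj; split=> //; exact: qB.
exact: IH (q \o succn) j qV1 (esym qj) (fun k => qB k.+1) qF.
Qed.

Lemma run_states n (q : nat -> Q) : q 0 = q0 ->
  (forall k, k < n -> B (q k) (q k.+1)) -> forall k, k <= n -> V (q k).
Proof.
move=> q00 qB; elim=> [|k IH] kn; first by rewrite q00.
by apply: VB (qB k kn); apply: IH; exact: ltnW.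
Qed.

(** Runs from [q0] never leave [V], so every letter of a trace lies in this alphabet and every
    visited state has an index in [I]. *)
Lemma regular_traces : regular (lab @` V) [set u | traces (Fin u)].
Proof.
exists fin_automaton; apply/seteqP; split=> u /=.
  move=> /traces_FinP[n [q [-> q00 qB qF]]]; split.
    have -> : map lab (mkseq q n.+1) = mkseq (lab \o q) n.+1 by rewrite -map_comp.
    apply: Forall_mkseq => k kn.
    by exists (q k) => //; exact: (run_states q00 qB).
  have [i _ qi] := fV V0; exists (Some i) => //.
  by apply: run_accepts_from; rewrite ?q00.
move=> [_ [[i|//] iq0 /accepts_from_run[n [q [-> q0i qB qF]]]]].
by apply/traces_FinP; exists n, q; split=> //; rewrite q0i.
Qed.

Lemma omega_regular_traces : omega_regular (lab @` V) [set w | traces (Inf w)].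
Proof.
exists inf_automaton; apply/seteqP; split=> w /=.
  move=> /traces_InfP[q [-> q00 qB]].
  have qV n : V (q n) by apply: (@run_states n) => // k _; exact: qB.
  split=> [n|]; first by exists (q n).
  pose r n := s2val (cid2 (fV (qV n))).
  have fr n : f (r n) = q n by rewrite /r; case: cid2.
  exists (Some \o r); split=> [|n|n] /=; last by exists n.
    by rewrite /trace_init /= fr.
  by rewrite /trace_trans /= !fr.
move=> [_ [r [r0 rB _]]].
have rS n : exists i, r n = Some i.
  (* The state [r n] has a successor, hence is not [None]. *)
  by move: (rB n); rewrite /= /trace_trans /=; case: (r n) => // i _; exists i.
pose i n := sval (cid (rS n)).
have ri n : r n = Some (i n) by rewrite /i; case: cid.
apply/traces_InfP; exists (f \o i); split=> [| |n] /=.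
- by apply/funext => n; have := rB n; rewrite /= /trace_trans /= !ri => -[].
- by move: r0; rewrite /= /trace_init /= ri.
- by have := rB n; rewrite /= /trace_trans /= !ri => -[].
Qed.

End FiniteStates.

Lemma traces_regular (V : set Q) :
  finite_set V -> V q0 -> (forall q q', V q -> B q q' -> V q') ->
  closed_language traces /\ infty_regular traces.
Proof.
move=> Vfin V0 VB; have [n [f fV]] := finite_set_cover Vfin.
split; first exact: traces_closed fV V0 VB.
exists (lab @` V); split; first exact: finite_image.
  exact: regular_traces fV V0 VB.
exact: omega_regular_traces fV V0 VB.
Qed.

End Traces.

Theorem proposition4 (Sg : signature) (Lbl Nm : Type)
    (R : rewrite_theory Sg Lbl) (D : set (strategy_def Sg Lbl Nm))
    (alpha : strategy Sg Lbl Nm) (t : term Sg) (t_ground : ground t) :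
  finite_set (reachable R D alpha t) ->
  closed_language (denotation R D alpha t) /\
  infty_regular (denotation R D alpha t).
Proof.
move=> Vfin.
(* The end condition of [Ex_fin]: control steps alone lead to a solution. *)
pose F q := exists2 t', ground t' & clos_refl_trans _ (step R D Ctl) q (XT t' [::]).
apply: (@traces_regular _ _ (@cterm _ _ _ R) (big_step R D) (start R alpha t) F _ Vfin).
  exact: rt_refl.
move=> q q' qr [q1 qq1 q1q']; apply: rt_trans qr _; apply: rt_trans (rt_step _ _ _ _ _).
  by apply: path_mono qq1 => x y xy; exists Ctl.
by exists Sys.
Qed.
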